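(* Let $k\ge 3$ and let $G=(V,E)$ be a $k$-uniform hypergraph with at least one edge. Let $\mathcal L,\mathcal Q$ be the Laplacian and signless Laplacian tensors of $G$, respectively. Then $$\lambda(\mathcal L)\le\lambda(\mathcal Q).$$ If furthermore $G$ is connected, then $\lambda(\mathcal L)=\lambda(\mathcal Q)$ if and only if $k$ is even and $G$ is odd-bipartite.
   Context: Hypergraphs are undirected, simple, $k$-uniform (every edge has exactly $k$ vertices), with vertex set $V=[n]=\{1,\dots,n\}$, $n\ge k$, and nonempty edge set $E$. The degree $d_i$ of vertex $i$ is the number of edges containing $i$. Two different vertices $i,j$ are connected if there are edges $e_1,\dots,e_m$ with $i\in e_1$, $j\in e_m$ and $e_r\cap e_{r+1}\ne\emptyset$ for all $r\in[m-1]$; $G$ is connected if every pair of different vertices is connected. The adjacency tensor $\mathcal A$ is the $k$-th order $n$-dimensional tensor with $a_{i_1\dots i_k}=\frac1{(k-1)!}$ if $\{i_1,\dots,i_k\}\in E$ and $0$ otherwise; $\mathcal D$ is the diagonal tensor with diagonal entries $d_{i\dots i}=d_i$; the Laplacian tensor is $\mathcal L=\mathcal D-\mathcal A$ and the signless Laplacian tensor is $\mathcal Q=\mathcal D+\mathcal A$. Thus $(\mathcal L\mathbf x^{k-1})_i=d_ix_i^{k-1}-\sum_{e\in E,\,i\in e}\prod_{j\in e\setminus\{i\}}x_j$, and $(\mathcal Q\mathbf x^{k-1})_i$ is the same with $+$ in place of $-$. A real number $\lambda$ is an H-eigenvalue of $\mathcal T$ with H-eigenvector $\mathbf x\in\mathbb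 R^n\setminus\{0\}$ if $(\mathcal T\mathbf x^{k-1})_i=\lambda x_i^{k-1}$ for all $i\in[n]$. $\lambda(\mathcal T)$ denotes the largest H-eigenvalue of $\mathcal T$ (it exists for $\mathcal L$ and $\mathcal Q$). For $k$ even, a (nontrivial) $k$-uniform hypergraph $G=(V,E)$ is odd-bipartite if there is a disjoint partition $V=V_1\cup V_2$ with $V_1,V_2\ne\emptyset$ such that every edge in $E$ intersects $V_1$ in exactly an odd number of vertices. *)

(* Defs.v *)
From mathcomp Require Import boolp classical_sets reals.
From mathcomp Require Import all_boot all_order all_algebra.
Set Implicit Arguments. Unset Strict Implicit. Unset Printing Implicit Defensive.
Import Order.TTheory GRing.Theory Num.Theory.
Local Open Scope ring_scope.

Record hypergraph (n k : nat) := Hypergraph {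
  edges : {set {set 'I_n}};
  edges_uniform : forall e, e \in edges -> #|e| = k
}.

Definition degree n k (G : hypergraph n k) (i : 'I_n) : nat :=
  #|[set e in edges G | i \in e]|.

(* The walk e_1, ..., e_m is the nonempty sequence e1 :: s. *)
Definition linked n k (G : hypergraph n k) (i j : 'I_n) : Prop :=
  exists (e1 : {set 'I_n}) (s : seq {set 'I_n}),
    [/\ {subset e1 :: s <= edges G},
        i \in e1,
        j \in last e1 s
      & path (fun e f => e :&: f != set0)%SET e1 s].

Definition connected_hypergraph n k (G : hypergraph n k) : Prop :=
  forall i j : 'I_n, i != j -> linked G i j.

Definition odd_bipartite n k (G : hypergraph n k) : Prop :=
  exists V1 V2 : {set 'I_n},
    [/\ V1 :|: V2 = [set: 'I_n]%SET,
        [disjoint V1 & V2],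
        V1 != set0,
        V2 != set0
      & forall e, e \in edges G -> odd #|e :&: V1|].

Notation tensor R n k := {ffun k.-tuple 'I_n -> R}.

(* (T x^(k-1))_i: the sum over all index tuples (i_1, ..., i_k) with i_1 = i of
   t_(i_1 ... i_k) x_(i_2) ... x_(i_k). *)
Definition tensor_apply (R : realType) n k (T : tensor R n k) (x : 'rV[R]_n)
    (i : 'I_n) : R :=
  \sum_(t : k.-tuple 'I_n | ohead t == Some i)
    T t * \prod_(j <- behead t) x 0 j.

Definition H_eigenvalue (R : realType) n k (T : tensor R n k) (lam : R) : Prop :=
  exists2 x : 'rV[R]_n, x != 0 &
    forall i, tensor_apply T x i = lam * x 0 i ^+ k.-1.

Definition largest_H_eigenvalue (R : realType) n k (T : tensor R n k)
    (lam : R) : Prop :=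
  H_eigenvalue T lam /\ forall mu, H_eigenvalue T mu -> mu <= lam.

(* The value is 0 if T has no largest H-eigenvalue; this never happens for the
   Laplacian and signless Laplacian tensors of a hypergraph with k >= 3 that
   has an edge. *)
Definition lambda_max (R : realType) n k (T : tensor R n k) : R :=
  xget 0 [set lam | largest_H_eigenvalue T lam]%classic.

(* As edges have exactly k vertices, a nonzero entry has distinct indices. *)
Definition adjacency_tensor (R : realType) n k (G : hypergraph n k) :
    tensor R n k :=
  [ffun t : k.-tuple 'I_n =>
    if [set j in t]%SET \in edges G then (k.-1)`!%:R^-1 else 0].

Definition degree_tensor (R : realType) n k (G : hypergraph n k) :
    tensor R n k :=
  [ffun t : k.-tuple 'I_n =>
    (if ohead t is Some i then
       if constant t then (degree G i)%:R else 0
     else 0) : R].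

Definition laplacian_tensor (R : realType) n k (G : hypergraph n k) :
    tensor R n k :=
  degree_tensor R G - adjacency_tensor R G.

Definition signless_laplacian_tensor (R : realType) n k (G : hypergraph n k) :
    tensor R n k :=
  degree_tensor R G + adjacency_tensor R G.

(* Main.v *)
(* For symmetric nonnegative tensors Perron-Frobenius theory is elementary: rho,
   the maximum of the form Q x^k over nonnegative x with sum x_i^k = 1, is
   attained by compactness, and Fermat's rule turns a maximizer into an
   H-eigenvector of Q.  If x is an eigenvector of L (or Q) for lam, then
   |lam| |x|^(k-1) <= Q |x|^(k-1), so pairing with |x| gives |lam| <= rho.

   If lam = rho, then |x| is a maximizer.  Connectedness makes it positive, and
   equality in the triangle inequality at the vertex i of an edge e forces
   sg(x_i)^k prod_(j in e) sg(x_j) = -1.  For k odd this is contradictory; for k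
   even the negative coordinates of x form an odd bipartition.  Conversely,
   flipping signs on one side of an odd bipartition exchanges the eigenvectors
   of L and Q. *)
Require Import Defs.
From mathcomp Require Import boolp classical_sets topology function_spaces.
From mathcomp Require Import normedtype derive realfun exp.
From mathcomp Require Import all_boot all_order all_algebra.
From mathcomp Require Import reals.
From mathcomp Require Import ring lra.
Import Order.TTheory GRing.Theory Num.Theory.
Import numFieldNormedType.Exports.
Local Open Scope ring_scope.
Set Implicit Arguments. Unset Strict Implicit. Unset Printing Implicit Defensive.

(** * Tensor actions as sums over edges *)

Definition edge_apply (R : realType) n k (G : hypergraph n k) (x : 'rV[R]_n)
    (i : 'I_n) : R :=
  \sum_(e in edges G | i \in e) \prod_(j in e :\ i) x 0 j.

Lemma tensor_apply_cons (R : realType) n m (T : tensor R n m.+1)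
    (x : 'rV[R]_n) i :
  tensor_apply T x i =
  \sum_(u : m.-tuple 'I_n) T (cons_tuple i u) * \prod_(j <- u) x 0 j.
Proof.
rewrite /tensor_apply (reindex_onto (fun u => cons_tuple i u)
  (fun t : m.+1.-tuple 'I_n => behead_tuple t)) /=; last first.
  by case=> [[|j s]] //= hs /eqP [->]; apply/val_inj.
apply: eq_bigl => u; rewrite eqxx /=.
by apply/eqP/val_inj.
Qed.

Lemma tensor_applyD (R : realType) n k (S T : tensor R n k) (x : 'rV[R]_n) i :
  tensor_apply (S + T) x i = tensor_apply S x i + tensor_apply T x i.
Proof.
by rewrite -big_split; apply: eq_bigr => t _; rewrite ffunE mulrDl.
Qed.

Lemma tensor_applyN (R : realType) n k (T : tensor R n k) (x : 'rV[R]_n) i :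
  tensor_apply (- T) x i = - tensor_apply T x i.
Proof.
by rewrite -sumrN; apply: eq_bigr => t _; rewrite ffunE mulNr.
Qed.

Lemma degree_tensor_apply (R : realType) n k (G : hypergraph n k)
    (x : 'rV[R]_n) i : (0 < k)%N ->
  tensor_apply (degree_tensor R G) x i = (degree G i)%:R * x 0 i ^+ k.-1.
Proof.
case: k G => // m G _; rewrite tensor_apply_cons (bigD1 (nseq_tuple m i)) //=.
rewrite ffunE /= all_pred1_nseq.
rewrite big_nseq -Monoid.iteropE big1 ?addr0 // => u ui.
rewrite ffunE /= ifN ?mul0r //; apply: contraNN ui => /all_pred1P.
by rewrite size_tuple => ui; apply/eqP/val_inj.
Qed.

(** An edge has [m.+1] vertices, so a tuple of that length covering it cannot repeat an index; its
    tail must enumerate the other vertices. *)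
Lemma edge_tuplesE n m (G : hypergraph n m.+1) e i (u : m.-tuple 'I_n) :
  e \in edges G -> i \in e ->
  ([set j in i :: u] == e) = all (mem (e :\ i)) u && uniq u.
Proof.
move=> eG ie; have ce := edges_uniform eG.
have ci : #|e :\ i| = m by have := cardsD1 i e; rewrite ie ce => -[].
apply/eqP/andP => [ue|[/allP ua uu]].
  have : uniq (i :: u).
    apply/card_uniqP; rewrite /= size_tuple -ce -ue.
    by apply: eq_card => j; rewrite inE.
  case/andP=> iu uu; split=> //; apply/allP => j ju /=.
  rewrite !inE -ue inE in_cons ju orbT andbT.
  by apply: contraNneq iu => <-.
apply/eqP; rewrite eqEcard; apply/andP; split.
  apply/subsetP => j; rewrite inE in_cons => /predU1P[->//|/ua].
  by rewrite /= !inE => /andP[].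
rewrite ce cardsE (card_uniqP _) /= ?size_tuple // uu andbT.
by apply/negP => /ua; rewrite /= !inE eqxx.
Qed.

(** Each edge through [i] comes from exactly [(k-1)!] tuples, the orderings of its other vertices,
    which cancels the factor in the entries. *)
Lemma adjacency_tensor_apply (R : realType) n k (G : hypergraph n k)
    (x : 'rV[R]_n) i : (0 < k)%N ->
  tensor_apply (adjacency_tensor R G) x i = edge_apply G x i.
Proof.
case: k G => // m G _; rewrite tensor_apply_cons.
transitivity (\sum_(u : m.-tuple 'I_n | [set j in i :: u] \in edges G)
    (m`!)%:R^-1 * \prod_(j <- u) x 0 j).
  rewrite [RHS]big_mkcond; apply: eq_bigr => u _; rewrite ffunE /=.
  by case: ifP => _; rewrite ?mul0r.
rewrite (partition_big (fun u : m.-tuple 'I_n => [set j in i :: u])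
  (fun e => (e \in edges G) && (i \in e))) /=; last first.
  by move=> u ->; rewrite inE mem_head.
apply: eq_bigr => e /andP[eG ie].
have ci : #|e :\ i| = m.
  by have := cardsD1 i e; rewrite ie (edges_uniform eG) => -[].
transitivity (\sum_(u : m.-tuple 'I_n | all (mem (e :\ i)) u && uniq u)
    (m`!)%:R^-1 * \prod_(j in e :\ i) x 0 j).
  apply: eq_big => u.
    rewrite -(edge_tuplesE u eG ie) andbC.
    by case: eqP => // ->; rewrite eG.
  case/andP=> _; rewrite (edge_tuplesE u eG ie) => /andP[/allP ua uu].
  congr (_ * _); rewrite big_uniq //=; apply: eq_bigl.
  apply/subset_cardP; last by apply/subsetP => j /ua.
  by rewrite (card_uniqP uu) size_tuple ci.
rewrite sumr_const -[LHS]mulr_natr mulrAC.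
have := card_uniq_tuples m (mem (e :\ i)); rewrite cardsE ci ffactnn => ->.
by rewrite mulVf ?mul1r // pnatr_eq0 -lt0n fact_gt0.
Qed.

Lemma laplacian_tensor_apply (R : realType) n k (G : hypergraph n k)
    (x : 'rV[R]_n) i : (0 < k)%N ->
  tensor_apply (laplacian_tensor R G) x i =
  (degree G i)%:R * x 0 i ^+ k.-1 - edge_apply G x i.
Proof.
by move=> k0; rewrite tensor_applyD tensor_applyN degree_tensor_apply //
  adjacency_tensor_apply.
Qed.

Lemma signless_laplacian_tensor_apply (R : realType) n k (G : hypergraph n k)
    (x : 'rV[R]_n) i : (0 < k)%N ->
  tensor_apply (signless_laplacian_tensor R G) x i =
  (degree G i)%:R * x 0 i ^+ k.-1 + edge_apply G x i.
Proof.
by move=> k0; rewrite tensor_applyD degree_tensor_apply //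
  adjacency_tensor_apply.
Qed.

(** * The homogeneous forms of degree [k] *)

(** This is [Q x^k]: pairing with [x] meets each edge once per vertex, hence the factor [k%:R]. *)
Definition signless_form (R : realType) n k (G : hypergraph n k)
    (x : 'rV[R]_n) : R :=
  \sum_i (degree G i)%:R * x 0 i ^+ k
  + k%:R * \sum_(e in edges G) \prod_(j in e) x 0 j.

Definition power_sum (R : realType) n (k : nat) (x : 'rV[R]_n) : R :=
  \sum_i x 0 i ^+ k.

Lemma edge_apply_ge0 (R : realType) n k (G : hypergraph n k)
    (x : 'rV[R]_n) i : (forall j, 0 <= x 0 j) -> 0 <= edge_apply G x i.
Proof. by move=> x0; apply: sumr_ge0 => e _; apply: prodr_ge0. Qed.

Lemma normr_edge_apply (R : realType) n k (G : hypergraph n k)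
    (x : 'rV[R]_n) i :
  `|edge_apply G x i| <= edge_apply G (map_mx Num.norm x) i.
Proof.
apply: le_trans (ler_norm_sum _ _ _) _; rewrite le_eqVlt; apply/orP; left.
apply/eqP/eq_bigr => e _; rewrite normr_prod.
by apply: eq_bigr => j _; rewrite mxE.
Qed.

Lemma signless_form_euler (R : realType) n k (G : hypergraph n k)
    (x : 'rV[R]_n) : (0 < k)%N ->
  \sum_i ((degree G i)%:R * x 0 i ^+ k.-1 + edge_apply G x i) * x 0 i =
  signless_form G x.
Proof.
move=> k0; under eq_bigr do rewrite mulrDl -mulrA -exprSr prednK //.
rewrite big_split; congr (_ + _).
rewrite [LHS](eq_bigr (fun i => \sum_(e in edges G | i \in e)
  \prod_(j in e) x 0 j)); last first.
  move=> i _; rewrite mulr_suml; apply: eq_bigr => e /andP[_ ie].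
  by rewrite [RHS](big_setD1 i) //= mulrC.
rewrite (exchange_big_dep (fun e => e \in edges G)) /=; last by move=> i e _ /andP[].
rewrite mulr_sumr; apply: eq_bigr => e eG.
under eq_bigl do rewrite eG.
by rewrite sumr_const (edges_uniform eG) mulr_natl.
Qed.

(** An edge contains [i] at most once, so the edge part is affine in [x_i]; the expansion is exact,
    and only the pure power calls for a Taylor estimate. *)
Lemma signless_form_shift (R : realType) n k (G : hypergraph n k)
    (x : 'rV[R]_n) i t :
  signless_form G (x + t *: delta_mx 0 i) = signless_form G x
  + (degree G i)%:R * ((x 0 i + t) ^+ k - x 0 i ^+ k)
  + k%:R * t * edge_apply G x i.
Proof.
have xi : (x + t *: delta_mx 0 i) 0 i = x 0 i + t.
  by rewrite !mxE !eqxx mulr1.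
have xj j : j != i -> (x + t *: delta_mx 0 i) 0 j = x 0 j.
  by rewrite !mxE => /negPf->; rewrite andbF mulr0 addr0.
rewrite /signless_form (bigD1 i) //= [in RHS](bigD1 i) //= xi.
under eq_bigr => j ji do rewrite xj //.
have -> : \sum_(e in edges G) \prod_(j in e) (x + t *: delta_mx 0 i) 0 j =
    \sum_(e in edges G) \prod_(j in e) x 0 j + t * edge_apply G x i.
  rewrite /edge_apply big_mkcondr mulr_sumr -big_split /=.
  apply: eq_bigr => e _; case: ifPn => ie.
    rewrite (big_setD1 i) // [in RHS](big_setD1 i) //= xi mulrDl.
    congr (_ * _ + _ * _); apply: eq_bigr => j; rewrite !inE => /andP[ji _];
      exact: xj.
  rewrite mulr0 addr0; apply: eq_bigr => j je; apply: xj.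
  by apply: contraNneq ie => <-.
ring.
Qed.

Lemma power_sum_shift (R : realType) n k (x : 'rV[R]_n) i t :
  power_sum k (x + t *: delta_mx 0 i) =
  power_sum k x + ((x 0 i + t) ^+ k - x 0 i ^+ k).
Proof.
rewrite /power_sum (bigD1 i) //= [in RHS](bigD1 i) //=.
rewrite [in LHS](eq_bigr (fun j => x 0 j ^+ k)); last first.
  by move=> j /negPf ji; rewrite !mxE ji andbF mulr0 addr0.
rewrite !mxE !eqxx /= mulr1; ring.
Qed.

(** * First-order conditions at a maximizer *)

Lemma exprD_taylor1 (R : realType) (y : R) m :
  exists2 C, 0 <= C & forall t, `|t| <= 1 ->
    `|(y + t) ^+ m - y ^+ m - m%:R * y ^+ m.-1 * t| <= C * t ^+ 2.
Proof.
elim: m => [|m [C C0 IH]].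
  by exists 0 => // t _; rewrite !expr0 subrr sub0r !mul0r oppr0 normr0.
exists ((`|y| + 1) * C + `|m%:R * y ^+ m.-1|).
  by rewrite addr_ge0 // mulr_ge0 // addr_ge0.
move=> t t1.
have -> : (y + t) ^+ m.+1 - y ^+ m.+1 - m.+1%:R * y ^+ m * t =
    (y + t) * ((y + t) ^+ m - y ^+ m - m%:R * y ^+ m.-1 * t)
    + m%:R * y ^+ m.-1 * t ^+ 2.
  (* The predecessor truncates at [m = 0], where the coefficient [m%:R] is zero. *)
  case: m {IH} => [|m] /=; first by rewrite !expr0 !expr1; ring.
  rewrite !exprS -!natr1; ring.
apply: le_trans (ler_normD _ _) _; rewrite [leRHS]mulrDl lerD //; last first.
  by rewrite [leLHS]normrM [`|t ^+ 2|]ger0_norm // sqr_ge0.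
rewrite normrM -[leRHS]mulrA ler_pM //; last exact: IH.
by apply: le_trans (ler_normD _ _) _; rewrite lerD2l.
Qed.

Lemma first_order_ge0 (R : realType) (B C d : R) :
  0 < d -> 0 <= C -> (forall t, 0 < t <= d -> - (C * t ^+ 2) <= B * t) -> 0 <= B.
Proof.
move=> d0 C0 H; rewrite leNgt; apply/negP => B0.
(* Every [t <= s] has [C * t < - B], so the linear term wins; the [+ 1] keeps the denominator
   positive when [C = 0]. *)
pose s := - B / (C + 1).
have C1 : 0 < C + 1 by lra.
have s0 : 0 < s by rewrite divr_gt0 // oppr_gt0.
have Cs : C * s < - B.
  have : (C + 1) * s = - B by rewrite /s mulrC divfK // gt_eqF.
  by move: s s0 => s s0; lra.
pose t := Num.min d s.
have t0 : 0 < t by rewrite lt_min d0.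
have := H t; rewrite t0 ge_min lexx /= => /(_ isT).
have ts : t <= s by rewrite ge_min lexx orbT.
rewrite expr2 mulrA -mulNr (ler_pM2r t0).
have : C * t <= C * s by rewrite ler_wpM2l.
lra.
Qed.

(* Fermat's rule in each coordinate; at a zero coordinate only the one-sided
   inequality is available, but there both sides of the eigenvalue equation
   are nonnegative. *)
Lemma maximizer_eigenvector (R : realType) n k (G : hypergraph n k) (rho : R)
    (y : 'rV[R]_n) : (1 < k)%N -> (forall i, 0 <= y 0 i) ->
  signless_form G y = rho * power_sum k y ->
  (forall z : 'rV[R]_n, (forall i, 0 <= z 0 i) ->
     signless_form G z <= rho * power_sum k z) ->
  forall i, (degree G i)%:R * y 0 i ^+ k.-1 + edge_apply G y i =
    rho * y 0 i ^+ k.-1.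
Proof.
move=> k1 y0 Fy Fmax i.
have k0 : 0 < k%:R :> R by rewrite ltr0n ltnW.
set a := y 0 i; set d : R := (degree G i)%:R; set A := edge_apply G y i.
have [C C0 taylor] := exprD_taylor1 a k.
(* [B * t] is the first-order part of [rho * power_sum - signless_form] after shifting coordinate
   [i] of [y] by [t]; this difference is nonnegative, and [C' * t ^+ 2] bounds the remainder. *)
pose B := k%:R * ((rho - d) * a ^+ k.-1 - A).
pose C' := `|rho - d| * C.
have C'0 : 0 <= C' by rewrite mulr_ge0.
have Hshift t : 0 <= a + t -> `|t| <= 1 -> - (C' * t ^+ 2) <= B * t.
  move=> at0 t1.
  have := Fmax (y + t *: delta_mx 0 i).
  rewrite signless_form_shift power_sum_shift Fy -/a -/d -/A.
  have z0 j : 0 <= (y + t *: delta_mx 0 i) 0 j.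
    rewrite !mxE eqxx /=; case: eqP => [->|_]; first by rewrite mulr1.
    by rewrite mulr0 addr0.
  move=> /(_ z0) H.
  have := taylor t t1; set r := _ - _ - _ => rC.
  have : `|(rho - d) * r| <= C' * t ^+ 2.
    by rewrite normrM -[leRHS]mulrA ler_wpM2l.
  rewrite ler_norml => /andP[_ +].
  have -> : (rho - d) * r = (rho - d) * ((a + t) ^+ k - a ^+ k) -
      (rho - d) * k%:R * a ^+ k.-1 * t by rewrite /r; ring.
  have -> : B * t = (rho - d) * k%:R * a ^+ k.-1 * t - k%:R * t * A.
    by rewrite /B; ring.
  move: ((a + t) ^+ k - a ^+ k) H => w H.
  lra.
have B0 : 0 <= B.
  apply: (@first_order_ge0 _ _ C' 1) => // t /andP[t0 t1].
  apply: Hshift; first by rewrite addr_ge0 ?y0 // ltW.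
  by rewrite gtr0_norm.
have Bk : A <= (rho - d) * a ^+ k.-1.
  by move: B0; rewrite /B pmulr_rge0 // subr_ge0.
have A0 : 0 <= A by apply: edge_apply_ge0.
suff : (rho - d) * a ^+ k.-1 <= A by lra.
have [a0|aN0] := eqVneq a 0.
  by rewrite a0 expr0n -subn1 subn_eq0 leqNgt k1 mulr0.
have a0 : 0 < a by rewrite lt_neqAle eq_sym aN0 y0.
(* When [a > 0], shifts by [- t] with [t <= a] stay nonnegative and give the reverse inequality. *)
have : 0 <= - B.
  apply: (@first_order_ge0 _ _ C' (Num.min 1 a)) => //.
    by rewrite lt_min ltr01.
  move=> t; rewrite le_min => /and3P[t0 t1 ta].
  have := Hshift (- t); rewrite sqrrN mulrN -mulNr; apply.
    by rewrite subr_ge0.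
  by rewrite normrN gtr0_norm.
by rewrite oppr_ge0 /B pmulr_rle0 // subr_le0.
Qed.

(** * Continuity, homogeneity and existence of a maximizer *)

Lemma continuous_coordX (R : realType) n k i :
  continuous (fun x : 'rV[R]_n => x 0 i ^+ k).
Proof.
move=> x; apply: (@continuous_comp _ _ _ (fun x : 'rV[R]_n => x 0 i)
  (fun a : R => a ^+ k)).
  exact: coord_continuous.
exact: exprn_continuous.
Qed.

Lemma continuous_power_sum (R : realType) n k :
  continuous (power_sum k : 'rV[R]_n -> R).
Proof.
apply: continuous_big; first exact: add_continuous.
by move=> i _; apply: continuous_coordX.
Qed.

Lemma continuous_signless_form (R : realType) n k (G : hypergraph n k) :
  continuous (signless_form G : 'rV[R]_n -> R).
Proof.
have c1 : continuous (fun x : 'rV[R]_n => \sum_i (degree G i)%:R * x 0 i ^+ k).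
  apply: continuous_big; first exact: add_continuous.
  move=> i _ x; exact: cvgMl_tmp (@continuous_coordX R n k i x).
have c2 : continuous (fun x : 'rV[R]_n =>
    \sum_(e in edges G) \prod_(j in e) x 0 j).
  apply: continuous_big; first exact: add_continuous.
  move=> e _; apply: continuous_big; first exact: mul_continuous.
  by move=> j _; apply: coord_continuous.
by move=> x; exact: cvgD (c1 x) (cvgMl_tmp (c2 x)).
Qed.

Lemma power_sumZ (R : realType) n k a (x : 'rV[R]_n) :
  power_sum k (a *: x) = a ^+ k * power_sum k x.
Proof. by rewrite mulr_sumr; apply: eq_bigr => i _; rewrite mxE exprMn. Qed.

Lemma signless_formZ (R : realType) n k (G : hypergraph n k) a (x : 'rV[R]_n) :
  signless_form G (a *: x) = a ^+ k * signless_form G x.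
Proof.
rewrite /signless_form mulrDr mulrCA !mulr_sumr; congr (_ + _).
  by apply: eq_bigr => i _; rewrite mxE exprMn mulrCA.
rewrite -!mulr_sumr; congr (_ * _); rewrite mulr_sumr.
apply: eq_bigr => e eG; rewrite -(edges_uniform eG) -prodr_const -big_split.
by apply: eq_bigr => j _; rewrite mxE.
Qed.

Lemma power_sum_ge0 (R : realType) n k (x : 'rV[R]_n) :
  (forall i, 0 <= x 0 i) -> 0 <= power_sum k x.
Proof. by move=> x0; apply: sumr_ge0 => i _; apply: exprn_ge0. Qed.

Lemma power_sum_gt0 (R : realType) n k (x : 'rV[R]_n) :
  (forall i, 0 <= x 0 i) -> x != 0 -> 0 < power_sum k x.
Proof.
move=> x0 /rV0Pn[i xi]; rewrite /power_sum (bigD1 i) //=.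
rewrite ltr_wpDr ?sumr_ge0 // => [j _|]; first exact: exprn_ge0.
by rewrite exprn_gt0 // lt_neqAle eq_sym xi x0.
Qed.

(** The maximum over nonnegative [x] with [power_sum k x = 1] exists by compactness, and homogeneity
    extends the bound to all nonnegative vectors. The index [i0] makes the compact set nonempty. *)
Lemma signless_form_max (R : realType) n k (G : hypergraph n k) (i0 : 'I_n) :
  (0 < k)%N ->
  exists y : 'rV[R]_n, [/\ forall i, 0 <= y 0 i, power_sum k y = 1 &
    forall z : 'rV[R]_n, (forall i, 0 <= z 0 i) ->
      signless_form G z <= signless_form G y * power_sum k z].
Proof.
move=> k0.
(* The unit cube supplies both nonnegativity and boundedness; a nonnegative vector of power sum 1
   lies in it automatically. *)
pose box := [set x : 'rV[R]_n | forall i, `[0, 1]%classic (x ord0 i)]%classic.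
pose sphere := (power_sum k @^-1` [set (1 : R)])%classic : set 'rV[R]_n.
have cbox : compact box 
  by apply: (@rV_compact R n (fun=> `[0, 1]%classic)) => i; apply: segment_compact.
have csphere : topology_structure.closed sphere.
  apply: (@preimage_closed 'rV[R]_n R (power_sum k) [set (1 : R)]%classic) => [x _|].
    exact: continuous_power_sum.
  exact: (@closed_eq R 1).
have mem_box (z : 'rV[R]_n) : (forall i, 0 <= z 0 i) -> power_sum k z = 1 ->
    (box `&` sphere)%classic z.
  move=> z0 Nz; split => // i /=; rewrite in_itv /= z0 /=.
  rewrite -(@ler_pXn2r _ k) ?nnegrE ?z0 // expr1n -Nz /power_sum (bigD1 i) //=.
  by rewrite lerDl sumr_ge0 // => j _; apply: exprn_ge0.
have [||c cA cmax] := @compact_EVT_max _ R (signless_form G)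
    (box `&` sphere)%classic _ (compact_closedI cbox csphere).
- exists (delta_mx 0 i0); apply: mem_box => [i|].
    by rewrite mxE ler0n.
  rewrite /power_sum (bigD1 i0) //= big1 ?addr0 ?mxE ?eqxx ?expr1n //.
  by move=> j /negPf ji; rewrite mxE ji andbF expr0n gtn_eqF.
- exact/continuous_subspaceT/continuous_signless_form.
have [bc Nc] := set_mem cA.
have c0 i : 0 <= c 0 i by have /= := bc i; rewrite in_itv => /andP[].
exists c; split => // z z0.
have [->|zN0] := eqVneq z 0.
  rewrite -(scale0r (0 : 'rV[R]_n)) signless_formZ power_sumZ expr0n gtn_eqF //.
  by rewrite !mul0r mulr0.
have Nz := power_sum_gt0 k z0 zN0.
(* Dividing by the [k]-th root of its power sum puts [z] on the sphere. *)
pose a := power_sum k z `^ (k%:R^-1).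
have a0 : 0 < a by rewrite powR_gt0.
have ak : a ^+ k = power_sum k z.
  rewrite -powR_mulrn ?ltW // -powRrM mulVf ?powRr1 ?ltW //.
  by rewrite pnatr_eq0 -lt0n.
have := cmax (a^-1 *: z); rewrite signless_formZ exprVn ak => H.
rewrite mulrC -ler_pdivrMl // ; apply: H; apply/mem_set/mem_box => [i|].
  by rewrite mxE mulr_ge0 // invr_ge0 ltW.
by rewrite power_sumZ exprVn ak mulVf // gt_eqF.
Qed.

(** * Connectedness and positivity of maximizers *)

(** Follow the walk: a vertex shared by consecutive edges either still satisfies [P], so the rest of
    the walk crosses, or shows that the current edge does. *)
Lemma linked_crossing_edge n k (G : hypergraph n k) (P : pred 'I_n) i j :
  linked G i j -> P i -> ~~ P j ->
  exists2 e, e \in edges G & exists a b, [/\ a \in e, b \in e, P a & ~~ P b].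
Proof.
move=> [e [s [sG + + +]]].
elim: s e i sG => [|f s IH] e i sG ie /=.
  move=> je _ Pi Pj; exists e; first by apply: sG; rewrite mem_head.
  by exists i, j.
move=> jl /andP[/set0Pn[v /setIP[ve vf]] pth] Pi Pj.
have [Pv|Pv] := boolP (P v); last first.
  by exists e; [apply: sG; rewrite mem_head | exists i, v].
by apply: (IH f v) => // g gs; apply: sG; rewrite in_cons gs orbT.
Qed.

(* If [y] had a zero, raising all its zeros to [eps] would increase the form by
   at least a multiple of [eps ^+ k.-1] on an edge that also meets the support
   of [y], but the power sum only by a multiple of [eps ^+ k]. *)
Lemma maximizer_gt0 (R : realType) n k (G : hypergraph n k) (rho : R)
    (y : 'rV[R]_n) : (0 < k)%N -> connected_hypergraph G -> 0 <= rho ->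
  (forall i, 0 <= y 0 i) -> y != 0 ->
  signless_form G y = rho * power_sum k y ->
  (forall z : 'rV[R]_n, (forall i, 0 <= z 0 i) ->
     signless_form G z <= rho * power_sum k z) ->
  forall i, 0 < y 0 i.
Proof.
move=> k0 Gconn rho0 y0 /rV0Pn[j0 yj0] Fy Fmax i0.
rewrite lt_neqAle eq_sym y0 andbT; apply/negP => yi0.
have lnk : linked G i0 j0 by apply: Gconn; apply: contraNneq yj0 => <-.
have [e eG [a [b [ae be /eqP ya yb]]]] :=
  linked_crossing_edge (P := fun i => y 0 i == 0) lnk yi0 yj0.
(* [c] omits the zero factors; over [e] the raised vector has product [c] times a power of [t]. *)
pose c := \prod_(j in e) (if y 0 j == 0 then 1 else y 0 j).
have c0 : 0 < c.
  apply: prodr_gt0 => j _; case: eqP => // /eqP yj.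
  by rewrite lt_neqAle eq_sym yj y0.
have : 0 <= - (k%:R * c).
  apply: (@first_order_ge0 _ _ (rho * n%:R) 1) => //.
    by rewrite mulr_ge0.
  move=> t /andP[t0 t1].
  pose z : 'rV[R]_n := \row_j (if y 0 j == 0 then t else y 0 j).
  have yz j : 0 <= y 0 j <= z 0 j.
    by rewrite y0 mxE /=; case: eqP => [->|//]; exact: ltW.
  have z0 j : 0 <= z 0 j by have /andP[] := yz j; apply: le_trans.
  have Nz : power_sum k z <= power_sum k y + n%:R * t ^+ k.
    rewrite /power_sum mulr_natl -[X in t ^+ k *+ X]card_ord -sumr_const -big_split.
    apply: ler_sum => j _; rewrite mxE; case: eqP => [->|_].
      by rewrite expr0n gtn_eqF //= add0r.
    by rewrite lerDl exprn_ge0 // ltW.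
  (* As [y 0 b] is nonzero, at most [k.-1] factors were raised to [t], and [t <= 1]. *)
  have edge_z : c * t ^+ k.-1 <= \prod_(j in e) z 0 j.
    have -> : \prod_(j in e) z 0 j =
        c * \prod_(j in e) (if y 0 j == 0 then t else 1).
      rewrite -big_split; apply: eq_bigr => j _; rewrite mxE /=.
      by case: ifP; rewrite ?mul1r ?mulr1.
    rewrite ler_wpM2l ?(ltW c0) // (big_setD1 b) //= (negPf yb) mul1r.
    have -> : k.-1 = #|e :\ b|.
      by rewrite -(edges_uniform eG) (cardsD1 b) be.
    rewrite -prodr_const; apply: ler_prod => j _; rewrite (ltW t0) /=.
    by case: ifP.
  have Fz : signless_form G y + k%:R * (c * t ^+ k.-1) <= signless_form G z.
    rewrite /signless_form -addrA -mulrDr; apply: lerD.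
      apply: ler_sum => j _; rewrite ler_wpM2l //.
      by have /andP[yj yzj] := yz j; rewrite lerXn2r ?nnegrE.
    rewrite ler_wpM2l // (bigD1 e) //= [leRHS](bigD1 e) //=.
    (* The zero at [a] kills the product of [y] over [e], so the whole product of [z] over [e] is
       gained. *)
    rewrite (big_setD1 a) //= ya mul0r add0r addrC lerD //.
    by apply: ler_sum => f _; apply: ler_prod.
  have key : k%:R * (c * t ^+ k.-1) <= rho * (n%:R * t ^+ k).
    have := Fmax z z0; have := ler_wpM2l rho0 Nz; rewrite mulrDr -Fy.
    lra.
  have tk : 0 < t ^+ k.-1 by rewrite exprn_gt0.
  have : k%:R * c <= rho * n%:R * t.
    rewrite -(ler_pM2r tk) -[leLHS]mulrA (le_trans key) // -!mulrA -exprS prednK //.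
  by rewrite mulNr lerN2 expr2 mulrA ler_pM2r.
by rewrite oppr_ge0 leNgt mulr_gt0 // ltr0n.
Qed.

(** * The spectral bound and largest H-eigenvalues *)

(** The equations of [L] and [Q] differ only in the sign of the edge term, so absolute values cover
    both. The triangle inequality at each vertex is multiplied by [|x_i|] and summed. *)
Lemma eigen_equation_bound (R : realType) n k (G : hypergraph n k) (lam : R)
    (x : 'rV[R]_n) : (0 < k)%N ->
  (forall i, `|lam * x 0 i ^+ k.-1 - (degree G i)%:R * x 0 i ^+ k.-1| =
     `|edge_apply G x i|) ->
  `|lam| * power_sum k (map_mx Num.norm x) <=
  signless_form G (map_mx Num.norm x).
Proof.
move=> k0 H; rewrite -signless_form_euler // mulr_sumr.
apply: ler_sum => i _; rewrite -{1}(prednK k0) exprSr mulrA ler_wpM2r //.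
  by rewrite mxE.
rewrite !mxE -normrX -normrM.
have -> : lam * x 0 i ^+ k.-1 = (degree G i)%:R * x 0 i ^+ k.-1 +
    (lam * x 0 i ^+ k.-1 - (degree G i)%:R * x 0 i ^+ k.-1) by ring.
apply: le_trans (ler_normD _ _) _; rewrite H normrM normr_nat lerD //.
exact: normr_edge_apply.
Qed.

Lemma map_norm_ge0 (R : realType) n (x : 'rV[R]_n) i :
  0 <= (map_mx Num.norm x) 0 i.
Proof. by rewrite mxE. Qed.

Lemma map_norm_neq0 (R : realType) n (x : 'rV[R]_n) :
  x != 0 -> map_mx Num.norm x != 0.
Proof. by move=> /rV0Pn[i xi]; apply/rV0Pn; exists i; rewrite mxE normr_eq0. Qed.

Lemma le_spectral_bound (R : realType) n k (G : hypergraph n k) (rho lam : R)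
    (x : 'rV[R]_n) : (0 < k)%N ->
  (forall z : 'rV[R]_n, (forall i, 0 <= z 0 i) ->
     signless_form G z <= rho * power_sum k z) ->
  x != 0 ->
  (forall i, `|lam * x 0 i ^+ k.-1 - (degree G i)%:R * x 0 i ^+ k.-1| =
     `|edge_apply G x i|) ->
  lam <= rho.
Proof.
move=> k0 Fmax x0 /(eigen_equation_bound k0) H.
apply: le_trans (ler_norm lam) _.
rewrite -(@ler_pM2r _ (power_sum k (map_mx Num.norm x))).
  by apply: le_trans H _; apply: Fmax => i; apply: map_norm_ge0.
by apply: power_sum_gt0; [exact: map_norm_ge0 | exact: map_norm_neq0].
Qed.

Lemma signless_largest_H_eigenvalue (R : realType) n k (G : hypergraph n k) :
  (1 < k)%N -> edges G != set0 ->
  exists rho : R, [/\ 0 < rho,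
    largest_H_eigenvalue (signless_laplacian_tensor R G) rho &
    forall z : 'rV[R]_n, (forall i, 0 <= z 0 i) ->
      signless_form G z <= rho * power_sum k z].
Proof.
move=> k1 /set0Pn[e eG]; have k0 := ltnW k1.
have [i ie] : exists i, i \in e.
  by apply/set0Pn; rewrite -card_gt0 (edges_uniform eG).
have [y [y0 Ny Fmax]] := @signless_form_max R n k G i k0.
exists (signless_form G y); split => //.
(* Testing with the unit vector at [i], seen as a shift of 0, bounds the maximum below by the degree
   of [i], which is positive as [i] lies in [e]. *)
- have := Fmax (delta_mx 0 i); rewrite -[delta_mx 0 i]scale1r -[1 *: _]add0r.
  rewrite signless_form_shift power_sum_shift.
  have -> : signless_form G (0 : 'rV[R]_n) = 0.
    by rewrite -(scale0r (0 : 'rV[R]_n)) signless_formZ expr0n gtn_eqF ?mul0r.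
  have -> : power_sum k (0 : 'rV[R]_n) = 0.
    by rewrite -(scale0r (0 : 'rV[R]_n)) power_sumZ expr0n gtn_eqF ?mul0r.
  rewrite mxE !add0r expr1n expr0n gtn_eqF // subr0 !mulr1 => H.
  have /H {}H : forall j, 0 <= (1 *: delta_mx 0 i : 'rV[R]_n) 0 j.
    by move=> j; rewrite !mxE mul1r ler0n.
  apply: lt_le_trans H; rewrite ltr_wpDr //.
    by rewrite mulr_ge0 // edge_apply_ge0 // => j; rewrite mxE.
  by rewrite ltr0n card_gt0; apply/set0Pn; exists e; rewrite inE eG.
- split.
    exists y.
      apply: contra_eq_neq Ny => ->; rewrite -(scale0r (0 : 'rV[R]_n)) power_sumZ.
      by rewrite expr0n gtn_eqF // mul0r eq_sym oner_eq0.
    move=> j; rewrite signless_laplacian_tensor_apply //.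
    by apply: maximizer_eigenvector => //; rewrite Ny mulr1.
  move=> mu [x x0 Hx]; apply: (le_spectral_bound k0 Fmax x0) => j.
  rewrite -Hx signless_laplacian_tensor_apply //; congr (`|_|); ring.
Qed.

Lemma lambda_maxE (R : realType) n k (T : tensor R n k) lam :
  largest_H_eigenvalue T lam -> lambda_max T = lam.
Proof.
move=> Tlam; apply: xget_unique => // mu Tmu.
by apply/eqP; rewrite eq_le Tlam.2 ?Tmu.2 //; [exact: Tlam.1|exact: Tmu.1].
Qed.

(** This serves for [L], where the default value 0 is compared with the positive largest
    H-eigenvalue of [Q]. *)
Lemma lambda_maxP (R : realType) n k (T : tensor R n k) :
  lambda_max T = 0 \/ H_eigenvalue T (lambda_max T).
Proof.
rewrite /lambda_max; case: xgetP => [lam _ [Hlam _]|_]; first by right.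
by left.
Qed.

(** * Sign flips along an odd bipartition *)

Lemma prodr_sign_mem (R : realType) (T : finType) (A B : {set T}) :
  \prod_(j in A) (-1) ^+ (j \in B) = (-1) ^+ #|A :&: B| :> R.
Proof.
rewrite (bigID (mem B)) /= mulrC big1 ?mul1r => [|j /andP[_ /negPf->]] //.
rewrite -prodr_const; apply: eq_big => [j|j /andP[_ ->]] //.
by rewrite inE.
Qed.

Lemma eq_lambda_max (R : realType) n k (S T : tensor R n k) :
  (forall lam, H_eigenvalue S lam <-> H_eigenvalue T lam) ->
  lambda_max S = lambda_max T.
Proof.
move=> ST; congr xget; apply/funext => lam; apply/propext.
by split=> -[/ST Hlam max]; split=> // mu /ST; apply: max.
Qed.

Definition flip (R : realType) n (V : {set 'I_n}) (x : 'rV[R]_n) : 'rV[R]_n :=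
  \row_j ((-1) ^+ (j \in V) * x 0 j).

Lemma flip_neq0 (R : realType) n (V : {set 'I_n}) (x : 'rV[R]_n) :
  x != 0 -> flip V x != 0.
Proof.
move=> /rV0Pn[i xi]; apply/rV0Pn; exists i.
by rewrite mxE mulf_neq0 // signr_eq0.
Qed.

(** The signs over a whole edge multiply to [-1]; dividing out the sign of [i] leaves the stated
    factor. *)
Lemma edge_apply_flip (R : realType) n k (G : hypergraph n k) (V : {set 'I_n})
    (x : 'rV[R]_n) i : (forall e, e \in edges G -> odd #|e :&: V|) ->
  edge_apply G (flip V x) i = - (-1) ^+ (i \in V) * edge_apply G x i.
Proof.
move=> Vodd; rewrite mulr_sumr; apply: eq_bigr => e /andP[eG ie].
under eq_bigr do rewrite mxE; rewrite big_split; congr (_ * _).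
have := prodr_sign_mem R e V; rewrite -signr_odd Vodd // (big_setD1 i) //= expr1.
by move/(canRL (signrMK _)); rewrite mulrN1.
Qed.

Lemma flip_exp (R : realType) n k (V : {set 'I_n}) (x : 'rV[R]_n) i :
  odd k -> flip V x 0 i ^+ k = (-1) ^+ (i \in V) * x 0 i ^+ k.
Proof. by move=> ok; rewrite mxE exprMn exprAC -(signr_odd _ k) ok expr1. Qed.

Lemma odd_bipartite_lambda_max (R : realType) n k (G : hypergraph n k) :
  (0 < k)%N -> ~~ odd k -> odd_bipartite G ->
  lambda_max (laplacian_tensor R G) =
  lambda_max (signless_laplacian_tensor R G).
Proof.
move=> k0 kev [V [_ [_ _ _ _ Vodd]]].
(* With [k.-1] odd, the flip multiplies the diagonal and edge terms at [i] by opposite signs, so it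
   swaps the equations of [L] and [Q] for the same [lam]. *)
have k1 : odd k.-1 by case: k k0 kev {G Vodd} => //= m _; rewrite negbK.
apply: eq_lambda_max => lam.
split=> -[x x0 Hx]; exists (flip V x); rewrite ?flip_neq0 // => i; move: (Hx i);
  rewrite laplacian_tensor_apply // signless_laplacian_tensor_apply // => Hi;
  by rewrite flip_exp // edge_apply_flip // [in RHS]mulrCA -Hi; ring.
Qed.

(** * The equality case *)

(** Multiplying the equation of [L] at [i] by [sg(x_i)^(k-1)] and subtracting it from that of [Q] at
    [|x|] leaves a vanishing sum of nonnegative edge terms, so each term is zero. *)
Lemma laplacian_eigenvector_signs (R : realType) n k (G : hypergraph n k)
    (rho : R) (x : 'rV[R]_n) : (0 < k)%N ->
  (forall i, x 0 i != 0) ->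
  (forall i, (degree G i)%:R * x 0 i ^+ k.-1 - edge_apply G x i =
     rho * x 0 i ^+ k.-1) ->
  (forall i, (degree G i)%:R * (map_mx Num.norm x) 0 i ^+ k.-1 +
     edge_apply G (map_mx Num.norm x) i = rho * (map_mx Num.norm x) 0 i ^+ k.-1) ->
  forall e i, e \in edges G -> i \in e ->
    Num.sg (x 0 i) ^+ k * \prod_(j in e) Num.sg (x 0 j) = -1.
Proof.
move=> k0 x0 Lx Qy e i eG ie.
have sg2 : Num.sg (x 0 i) ^+ 2 = 1 by rewrite sqr_sg x0.
set s := Num.sg (x 0 i) ^+ k.-1.
have sx : s * x 0 i ^+ k.-1 = `|x 0 i| ^+ k.-1.
  by rewrite /s -exprMn normrEsg.
have sum0 : \sum_(f in edges G | i \in f)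
    (\prod_(j in f :\ i) `|x 0 j| + s * \prod_(j in f :\ i) x 0 j) = 0.
  rewrite big_split -mulr_sumr -/(edge_apply G x i) /=.
  have := Qy i; rewrite mxE -sx.
  have -> : edge_apply G (map_mx Num.norm x) i =
      \sum_(f in edges G | i \in f) \prod_(j in f :\ i) `|x 0 j|.
    by apply: eq_bigr => f _; apply: eq_bigr => j _; rewrite mxE.
  move=> H2.
  have -> : edge_apply G x i = (degree G i)%:R * x 0 i ^+ k.-1 -
    rho * x 0 i ^+ k.-1 by rewrite -Lx; ring.
  move: H2; set Y := \sum_(_ in _ | _) \prod_(_ in _) `|_| => H2.
  have -> : Y = rho * (s * x 0 i ^+ k.-1) - (degree G i)%:R * (s * x 0 i ^+ k.-1).
    by rewrite -H2; ring.
  ring.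
have s1 : `|s| = 1 by rewrite normrX normr_sg x0 expr1n.
have term_ge0 (f : {set 'I_n}) : (f \in edges G) && (i \in f) ->
    0 <= \prod_(j in f :\ i) `|x 0 j| + s * \prod_(j in f :\ i) x 0 j.
  move=> _; rewrite -normr_prod; set p := \prod_(_ in _) _.
  have -> : `|p| = `|s * p| by rewrite normrM s1 mul1r.
  by rewrite -lerBlDr sub0r -normrN ler_norm.
have term0 : \prod_(j in e :\ i) `|x 0 j| + s * \prod_(j in e :\ i) x 0 j = 0.
  by apply: (psumr_eq0P term_ge0 sum0); rewrite eG.
have prod0 : \prod_(j in e :\ i) `|x 0 j| != 0.
  by apply/prodf_neq0 => j _; rewrite normr_eq0.
have sprod : s * \prod_(j in e :\ i) Num.sg (x 0 j) = -1.
  apply: (mulIf prod0); rewrite mulN1r -mulrA -big_split /=.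
  under eq_bigr do rewrite -numEsg.
  by apply/eqP; rewrite -addr_eq0 addrC term0.
(* The extra factors [sg(x_i)], one from the power and one from the product, cancel. *)
rewrite (big_setD1 i) //= -{1}(prednK k0) exprSr -/s.
by rewrite mulrA -[s * _ * _]mulrA -expr2 sg2 mulr1.
Qed.

Lemma sign_pattern_odd_bipartite (R : realType) n k (G : hypergraph n k)
    (x : 'rV[R]_n) : (0 < k)%N -> edges G != set0 ->
  (forall i, x 0 i != 0) ->
  (forall e i, e \in edges G -> i \in e ->
    Num.sg (x 0 i) ^+ k * \prod_(j in e) Num.sg (x 0 j) = -1) ->
  ~~ odd k /\ odd_bipartite G.
Proof.
move=> k0 /set0Pn[e0 e0G] x0 Hsg.
have edge_vertex e : e \in edges G -> exists i, i \in e.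
  by move=> eG; apply/set0Pn; rewrite -card_gt0 (edges_uniform eG).
have kev : ~~ odd k.
  apply/negP => ok; have [i ie] := edge_vertex _ e0G.
  have sgk j : Num.sg (x 0 j) ^+ k = Num.sg (x 0 j).
    by rewrite -neqr0_sign // exprAC -(signr_odd _ k) ok expr1.
  pose P := \prod_(j in e0) Num.sg (x 0 j).
  have sgP j : j \in e0 -> Num.sg (x 0 j) * P = -1.
    by move=> je; rewrite -(Hsg _ _ e0G je) sgk.
  have P2 : P ^+ 2 = 1.
    have -> : P = - Num.sg (x 0 i).
      by rewrite -mulrN1 -(sgP i ie) mulrA -expr2 sqr_sg x0 mul1r.
    by rewrite sqrrN sqr_sg x0.
  (* Regrouped, this product is [P^(k+1)], an even power of a sign; but every factor is [-1], which
     gives [(-1)^k = -1]. *)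
  have : \prod_(j in e0) (Num.sg (x 0 j) * P) = 1.
    rewrite big_split /= -/P prodr_const (edges_uniform e0G) -exprS.
    by move/eqP: P2; rewrite sqrf_eq1 => /orP[]/eqP -> //=;
      rewrite ?expr1n // -signr_odd /= ok.
  rewrite (eq_bigr _ sgP) prodr_const (edges_uniform e0G) -signr_odd ok expr1.
  lra.
have negE (e : {set 'I_n}) : \prod_(j in e) Num.sg (x 0 j) =
    (-1) ^+ #|e :&: [set j | x 0 j < 0]|.
  rewrite -prodr_sign_mem; apply: eq_bigr => j _.
  by rewrite inE neqr0_sign.
pose V := [set j | x 0 j < 0].
have Vodd e : e \in edges G -> odd #|e :&: V|.
  move=> eG; have [i ie] := edge_vertex _ eG.
  have := Hsg e i eG ie; rewrite negE -neqr0_sign // exprAC.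
  rewrite -(signr_odd _ k) (negPf kev) expr1n mul1r -signr_odd.
  by case: odd => //; rewrite expr0; lra.
split=> //; exists V, (~: V); split=> //.
- by rewrite setUCr.
- by rewrite -setI_eq0 setICr.
(* If [V] were empty it would meet [e0] in 0 vertices; if its complement were empty, in [k]
   vertices. Both numbers are even. *)
- apply: contraL (Vodd _ e0G) => /eqP ->.
  by rewrite setI0 cards0.
- apply: contraL (Vodd _ e0G) => /eqP VC.
  by rewrite -(setCK V) VC setC0 setIT (edges_uniform e0G).
Qed.

Lemma eq_lambda_max_odd_bipartite (R : realType) n k (G : hypergraph n k) :
  (1 < k)%N -> edges G != set0 -> connected_hypergraph G ->
  lambda_max (laplacian_tensor R G) =
    lambda_max (signless_laplacian_tensor R G) ->
  ~~ odd k /\ odd_bipartite G.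
Proof.
move=> k1 E0 Gconn; have k0 := ltnW k1.
have [rho [rho0 Qrho Fmax]] := signless_largest_H_eigenvalue R k1 E0.
rewrite (lambda_maxE Qrho) => Lrho.
have := lambda_maxP (laplacian_tensor R G); rewrite Lrho.
(* Positivity of [rho] excludes the default value, so [rho] is an actual H-eigenvalue of [L]. *)
case=> [r0|[x xN0 Lx]]; first by rewrite r0 ltxx in rho0.
have {}Lx i : (degree G i)%:R * x 0 i ^+ k.-1 - edge_apply G x i =
    rho * x 0 i ^+ k.-1 by rewrite -Lx laplacian_tensor_apply.
have y0 := map_norm_ge0 x.
have Fy : signless_form G (map_mx Num.norm x) =
    rho * power_sum k (map_mx Num.norm x).
  (* The maximum bounds the form above and the eigenvalue equation bounds it below, so [|x|] attains
     the maximum. *)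
  apply/eqP; rewrite eq_le Fmax // -[X in X * _]ger0_norm ?(ltW rho0) //.
  apply: eigen_equation_bound => // i; rewrite -Lx -normrN.
  by congr (`|_|); ring.
have yN0 := map_norm_neq0 xN0.
have ypos := maximizer_gt0 k0 Gconn (ltW rho0) y0 yN0 Fy Fmax.
have x0 i : x 0 i != 0 by have := ypos i; rewrite mxE normr_gt0.
apply: (@sign_pattern_odd_bipartite R _ _ _ x) => //.
apply: laplacian_eigenvector_signs Lx _ => //.
exact: maximizer_eigenvector.
Qed.

Theorem theorem5p2 (R : realType) (n k : nat) (hk : (3 <= k)%N)
    (G : hypergraph n k) (hE : edges G != set0) :
  lambda_max (laplacian_tensor R G) <= lambda_max (signless_laplacian_tensor R G)
  /\ (connected_hypergraph G ->
      (lambda_max (laplacian_tensor R G) =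
         lambda_max (signless_laplacian_tensor R G)
       <-> ~~ odd k /\ odd_bipartite G)).
Proof.
have k1 : (1 < k)%N := ltnW hk; have k0 := ltnW k1.
split; last first.
  move=> Gconn; split; first exact: eq_lambda_max_odd_bipartite.
  by case=> kev Gob; apply: odd_bipartite_lambda_max.
have [rho [rho0 Qrho Fmax]] := signless_largest_H_eigenvalue R k1 hE.
rewrite (lambda_maxE Qrho).
case: (lambda_maxP (laplacian_tensor R G)) => [->|[x xN0 Lx]]; first exact: ltW.
apply: (le_spectral_bound k0 Fmax xN0) => i.
rewrite -Lx laplacian_tensor_apply // -normrN; congr (`|_|); ring.
Qed.
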